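(* Consider the linear model $\mathbf{y}=\boldsymbol{\Phi}\boldsymbol{\theta}_\circ+\boldsymbol{\varepsilon}$, where $\boldsymbol{\Phi}\in\mathbb{R}^{n\times d}$ and $\boldsymbol{\theta}_\circ\in\mathbb{R}^d$ are fixed and $\boldsymbol{\varepsilon}$ is a zero-mean random vector with covariance matrix $\mathbf{V}_\circ\succeq\mathbf{0}$. Among all linear estimators, the minimum mean-squared error $\mathrm{MSE}(\boldsymbol{\theta}_\circ)$ is attained by $\widehat{\boldsymbol{\theta}}(\mathbf{C},\mathbf{V})$ with weight matrices $$\mathbf{C}=\alpha\,\boldsymbol{\theta}_\circ\boldsymbol{\theta}_\circ^\top\quad\text{and}\quad\mathbf{V}=\alpha\mathbf{V}_\circ,$$ for any $\alpha>0$.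
   Context: $\mathbf{X}^\dagger$ is the Moore-Penrose pseudoinverse, $\mathcal{R}(\mathbf{M})$ the range of $\mathbf{M}$, and $\|\mathbf{x}\|_{\mathbf{W}}=\sqrt{\mathbf{x}^\top\mathbf{W}\mathbf{x}}$ for $\mathbf{W}\succeq\mathbf{0}$. A linear estimator is one of the form $\widehat{\boldsymbol{\theta}}=\mathbf{K}\mathbf{y}$ with $\mathbf{K}$ a $d\times n$ matrix independent of $\mathbf{y}$ (it may depend on $\boldsymbol{\theta}_\circ$ and $\mathbf{V}_\circ$). $\mathrm{MSE}(\boldsymbol{\theta}_\circ)=\mathbb{E}[\|\boldsymbol{\theta}_\circ-\widehat{\boldsymbol{\theta}}\|_2^2]$, with expectation over $\boldsymbol{\varepsilon}$. For positive semi-definite $\mathbf{C}$ ($d\times d$) and $\mathbf{V}$ ($n\times n$), $\widehat{\boldsymbol{\theta}}(\mathbf{C},\mathbf{V})$ is the minimizer of $\|\mathbf{y}-\boldsymbol{\Phi}\boldsymbol{\theta}\|_{\mathbf{V}^\dagger}^2+\|\boldsymbol{\theta}\|_{\mathbf{C}^\dagger}^2$ over $\{\boldsymbol{\theta}:\mathbf{y}-\boldsymbol{\Phi}\boldsymbol{\theta}\in\mathcal{R}(\mathbf{V}),\ \boldsymbol{\theta}\in\mathcal{R}(\mathbf{C})\}$; it equals $\mathbf{C}\boldsymbol{\Phi}^\top\mathbf{R}^\dagger\mathbf{y}$ with $\mathbf{R}=\boldsymbol{\Phi}\mathbf{C}\boldsymbol{\Phi}^\top+\mathbf{V}$ whenever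 $\mathbf{y}\in\mathcal{R}(\mathbf{R})$. *)

(* Defs.v *)
From HB Require Import structures.
From mathcomp Require Import all_boot all_order all_algebra.
From mathcomp Require Import all_classical all_reals all_analysis.

Set Implicit Arguments.
Unset Strict Implicit.
Unset Printing Implicit Defensive.

Import Order.TTheory GRing.Theory Num.Theory.

Local Open Scope classical_set_scope.
Local Open Scope ring_scope.

(* The four Penrose equations. *)
Definition penrose (R : realType) (m n : nat) (A : 'M[R]_(m, n))
    (X : 'M[R]_(n, m)) : Prop :=
  [/\ A *m X *m A = A, X *m A *m X = X,
      (A *m X)^T = A *m X & (X *m A)^T = X *m A].

(* The default value 0 is never used: see [mpinvP] and [penrose_uniq].
   MathComp's [pinvmx] is only some generalized inverse. *)
Definition mpinv (R : realType) (m n : nat) (A : 'M[R]_(m, n)) : 'M[R]_(n, m) :=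
  xget 0 [set X | penrose A X].

Definition psdmx (R : realType) (n : nat) (W : 'M[R]_n) : Prop :=
  W^T = W /\ forall x : 'cV[R]_n, 0 <= (x^T *m W *m x) 0 0.

Definition mxrange (R : realType) (m n : nat) (M : 'M[R]_(m, n)) :
    set 'cV[R]_m :=
  range (fun x : 'cV[R]_n => M *m x).

Definition wnorm (R : realType) (n : nat) (W : 'M[R]_n) (x : 'cV[R]_n) : R :=
  Num.sqrt ((x^T *m W *m x) 0 0).

(* The norm [`|x|] that the library puts on matrices is the sup norm. *)
Definition norm2 (R : realType) (n : nat) (x : 'cV[R]_n) : R :=
  Num.sqrt (\sum_i x i 0 ^+ 2).

Section WeightedEstimator.
Variables (R : realType) (n d : nat).
Variables (Phi : 'M[R]_(n, d)) (C : 'M[R]_d) (V : 'M[R]_n) (y : 'cV[R]_n).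

Definition feasible : set 'cV[R]_d :=
  [set theta | mxrange V (y - Phi *m theta) /\ mxrange C theta].

Definition objective (theta : 'cV[R]_d) : R :=
  wnorm (mpinv V) (y - Phi *m theta) ^+ 2 + wnorm (mpinv C) theta ^+ 2.

Definition minimizers : set 'cV[R]_d :=
  [set theta | feasible theta /\
    forall theta', feasible theta' -> objective theta <= objective theta'].

(* The value 0 is taken when there is no minimizer, in particular when
   [feasible] is empty. *)
Definition estimator : 'cV[R]_d := xget 0 minimizers.

End WeightedEstimator.

Definition observation (R : realType) (disp : measure_display)
    (T : measurableType disp) (P : probability T R) (n d : nat)
    (Phi : 'M[R]_(n, d)) (theta0 : 'cV[R]_d) (eps : 'I_n -> {RV P >-> R})
    (w : T) : 'cV[R]_n :=
  Phi *m theta0 + \col_i eps i w.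

Definition MSE (R : realType) (disp : measure_display)
    (T : measurableType disp) (P : probability T R) (d : nat)
    (theta0 : 'cV[R]_d) (theta_hat : T -> 'cV[R]_d) : \bar R :=
  'E_P[fun w => (norm2 (theta0 - theta_hat w) ^+ 2)%R]%E.

Lemma penrose_uniq (R : realType) (m n : nat) (A : 'M[R]_(m, n))
    (X Y : 'M[R]_(n, m)) : penrose A X -> penrose A Y -> X = Y.
Proof.
move=> [X1 X2 X3 X4] [Y1 Y2 Y3 Y4].
have AXY : A *m X = A *m Y.
  rewrite -{1}Y1 -(mulmxA (A *m Y)) -Y3 -X3 -trmx_mul.
  by rewrite (mulmxA (A *m X)) X1.
have XYA : X *m A = Y *m A.
  rewrite -{1}Y1 -(mulmxA A) mulmxA -X4 -Y4 -trmx_mul.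
  by rewrite -(mulmxA Y) (mulmxA A) X1.
by rewrite -X2 -mulmxA AXY mulmxA XYA Y2.
Qed.

Lemma gram_unit (R : realType) (m n : nat) (U : 'M[R]_(m, n)) :
  row_free U -> U *m U^T \in unitmx.
Proof.
move=> Ufree; rewrite -row_free_unit; apply: inj_row_free => v vUU.
apply: (row_free_inj Ufree); rewrite mul0mx.
have : (v *m U) *m (v *m U)^T = 0.
  by rewrite trmx_mul -mulmxA (mulmxA U) mulmxA vUU mul0mx.
move=> /matrixP/(_ 0 0); rewrite !mxE => /eqP; rewrite psumr_eq0; last first.
  by move=> i _; rewrite [_^T _ _]mxE -expr2 sqr_ge0.
move=> /allP vU0; apply/matrixP => i j; rewrite ord1 [RHS]mxE.
have := vU0 j (mem_index_enum j).
by rewrite [_^T _ _]mxE /= -expr2 sqrf_eq0 => /eqP.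
Qed.

Lemma mpinvP (R : realType) (m n : nat) (A : 'M[R]_(m, n)) :
  penrose A (mpinv A).
Proof.
suff [X AX] : exists X, penrose A X by apply: (xgetPex 0); exists X.
have : row_full (col_base A) by exact: col_base_full.
have : row_free (row_base A) by exact: row_base_free.
move: (row_base A) (col_base A) (mulmx_base A).
move: (\rank A) => r U L <- {A} Ufree Lfull.
have Uu : U *m U^T \in unitmx by apply: gram_unit.
have Lu : L^T *m L \in unitmx.
  by rewrite -{2}(trmxK L); apply: gram_unit; rewrite /row_free mxrank_tr.
pose RU := U^T *m invmx (U *m U^T); pose LL := invmx (L^T *m L) *m L^T.
have UR : U *m RU = 1%:M by rewrite mulmxA mulmxV.
have LLL : LL *m L = 1%:M by rewrite -mulmxA mulVmx.
have AX : L *m U *m (RU *m LL) = L *m LL.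
  by rewrite -mulmxA (mulmxA U) UR mul1mx.
have XA : RU *m LL *m (L *m U) = RU *m U.
  by rewrite -mulmxA (mulmxA LL) LLL mul1mx.
exists (RU *m LL); split; rewrite ?AX ?XA.
- by rewrite -mulmxA (mulmxA LL) LLL mul1mx.
- by rewrite -mulmxA (mulmxA U) UR mul1mx.
- by rewrite /LL !trmx_mul trmxK trmx_inv trmx_mul trmxK mulmxA.
- by rewrite /RU !trmx_mul trmxK trmx_inv trmx_mul trmxK mulmxA.
Qed.

(* Main.v *)
Require Import Defs.
From HB Require Import structures.
From mathcomp Require Import all_boot all_order all_algebra.
From mathcomp Require Import all_classical all_reals all_analysis.
From mathcomp Require Import measurable_realfun.
From mathcomp Require Import ring lra.

(** Why the theorem holds.  Write S = Phi C Phi^T + V.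

    Closed form.  Let y = S x.  A feasible theta has the form C w with
    y - Phi theta = V a, and its objective is a^T V a + w^T C w, because the
    pseudoinverses cancel inside the two weighted norms.  The choice a = x,
    w = Phi^T x is feasible.  Any other choice has increments b of a and u of w
    tied by V b = - Phi C u, which makes the two cross terms cancel: the
    objective grows by b^T V b + u^T C u.  This is nonnegative, and zero only
    if C u = 0, so C Phi^T x is the one minimizer ([minimizers_set1]).

    Almost sure linearity.  The component of the noise orthogonal to the range
    of V0 has zero second moment, so the noise lies in the range of V0 almost
    surely ([noise_range]).  As theta0 is in the range of C, the observation is
    then in the range of S, the sum of the ranges of Phi C and V
    ([mulmx_mpinv_sum]), and the estimator is K0 y with K0 = C Phi^T S^+.

    Optimality.  The error of a linear estimator K y is bias plus noise, so,
    with z = Phi theta0, its mean squared error is the sum over the rows k of K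
    of (theta0_i - k z)^2 + k V0 k^T ([MSE_linear]).  Each summand is a convex
    quadratic function of k, minimal where k (z z^T + V0) = theta0_i z^T
    ([risk_minimal]).  For the given C and V one has S = alpha (z z^T + V0) and
    C Phi^T = alpha theta0 z^T, so the rows of K0 solve these normal equations
    exactly when K0 S = C Phi^T, which is [gain_mulmx].

    The estimator is only known to agree with K0 y almost surely, so comparing
    its mean squared error with that of K0 y calls for an integral inequality
    whose smaller side need not be measurable
    ([ae_ge0_le_integral_nonmeas]). *)

Set Implicit Arguments.
Unset Strict Implicit.
Unset Printing Implicit Defensive.

Import Order.TTheory GRing.Theory Num.Theory.

Local Open Scope classical_set_scope.
Local Open Scope ring_scope.

(** * Positive semidefinite forms and pseudoinverses *)

Section QuadraticForms.
Variable R : realType.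

Lemma psdmxD n (A B : 'M[R]_n) : psdmx A -> psdmx B -> psdmx (A + B).
Proof.
move=> [As Ap] [Bs Bp]; split=> [|x]; first by rewrite linearD /= As Bs.
by rewrite mulmxDr mulmxDl mxE addr_ge0.
Qed.

Lemma psdmxZ n a (A : 'M[R]_n) : 0 <= a -> psdmx A -> psdmx (a *: A).
Proof.
move=> a0 [As Ap]; split=> [|x]; first by rewrite linearZ /= As.
by rewrite -scalemxAr -scalemxAl mxE mulr_ge0.
Qed.

Lemma psdmx_congr m n (F : 'M[R]_(m, n)) (A : 'M[R]_n) :
  psdmx A -> psdmx (F *m A *m F^T).
Proof.
move=> [As Ap]; split=> [|x]; first by rewrite !trmx_mul trmxK As mulmxA.
have -> : x^T *m (F *m A *m F^T) *m x = (F^T *m x)^T *m A *m (F^T *m x).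
  by rewrite trmx_mul trmxK !mulmxA.
exact: Ap.
Qed.

Lemma psdmx_outer n (t : 'cV[R]_n) : psdmx (t *m t^T).
Proof.
split=> [|x]; first by rewrite trmx_mul trmxK.
have -> : x^T *m (t *m t^T) *m x = (t^T *m x)^T *m (t^T *m x).
  by rewrite trmx_mul trmxK !mulmxA.
by rewrite mxE sumr_ge0 // => i _; rewrite mxE -expr2 sqr_ge0.
Qed.

Lemma sqnorm_eq0 n (x : 'cV[R]_n) : (x^T *m x) 0 0 = 0 -> x = 0.
Proof.
rewrite mxE => /eqP; rewrite psumr_eq0 => [/allP x0|i _]; last first.
  by rewrite mxE -expr2 sqr_ge0.
apply/matrixP => i j; rewrite ord1 [RHS]mxE.
by have := x0 i (mem_index_enum i); rewrite mxE /= -expr2 sqrf_eq0 => /eqP.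
Qed.

Lemma trmx11 (A : 'M[R]_1) : A^T = A.
Proof. by apply/matrixP => i j; rewrite mxE !ord1. Qed.

Lemma sym_formC n (A : 'M[R]_n) (x y : 'cV[R]_n) : A^T = A ->
  y^T *m A *m x = x^T *m A *m y.
Proof. by move=> As; rewrite -[LHS]trmx11 !trmx_mul trmxK As mulmxA. Qed.

Lemma sym_formD n (A : 'M[R]_n) (x y : 'cV[R]_n) : A^T = A ->
  ((x + y)^T *m A *m (x + y)) 0 0 =
  (x^T *m A *m x) 0 0 + (x^T *m A *m y) 0 0 *+ 2 + (y^T *m A *m y) 0 0.
Proof.
move=> As; rewrite [(x + y)^T]linearD /= !mulmxDl !mulmxDr (sym_formC x y As).
by rewrite !mxE; ring.
Qed.

(** An isotropic vector of a semidefinite form is in its kernel: otherwise, as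
    x^T A x = 0, moving from x along - A x would decrease the form linearly and
    make it negative. *)
Lemma psdmx_form_eq0 n (A : 'M[R]_n) (x : 'cV[R]_n) :
  psdmx A -> (x^T *m A *m x) 0 0 = 0 -> A *m x = 0.
Proof.
move=> [As Ap] xAx; apply: sqnorm_eq0; set v := A *m x.
set q := (v^T *m v) 0 0; pose p := (v^T *m A *m v) 0 0.
have p0 : 0 <= p by exact: Ap.
have pos (l : R) : 0 <= l * q *+ 2 + l ^+ 2 * p.
  have := Ap (x + l *: v); rewrite sym_formD // xAx add0r.
  have -> : x^T *m A = v^T by rewrite trmx_mul As.
  rewrite [(l *: v)^T]linearZ /= -!scalemxAl -!scalemxAr.
  have scE c (M : 'M[R]_1) : (c *: M) 0 0 = c * M 0 0 by rewrite mxE.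
  by rewrite !scE -/p -/q mulrA -expr2.
(* The minimizer - q / p would do if p were nonzero; p + 1 avoids the case. *)
have := pos (- (q / (p + 1))).
have -> : - (q / (p + 1)) * q *+ 2 + (- (q / (p + 1))) ^+ 2 * p =
          - (q ^+ 2 * ((p + 2) / (p + 1) ^+ 2)).
  by field; rewrite gt_eqF //; lra.
rewrite oppr_ge0 pmulr_lle0; last by rewrite divr_gt0 ?exprn_gt0 //; lra.
by move=> q2; apply/eqP; rewrite -sqrf_eq0 eq_le q2 sqr_ge0.
Qed.

(** No cancellation can occur in a sum of semidefinite forms, so the kernel of
    the sum is contained in the kernel of each term. *)
Lemma psdmx_ker_add n (A B : 'M[R]_n) (x : 'cV[R]_n) :
  psdmx A -> psdmx B -> (A + B) *m x = 0 -> A *m x = 0.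
Proof.
move=> Ap Bp ABx; apply: psdmx_form_eq0 => //; apply/eqP.
have : (x^T *m (A + B) *m x) 0 0 = 0 by rewrite -mulmxA ABx mulmx0 mxE.
rewrite mulmxDr mulmxDl mxE => /eqP; rewrite paddr_eq0 ?Ap.2 ?Bp.2 //.
by case/andP.
Qed.

Lemma psdmx_ker_congr m n (F : 'M[R]_(m, n)) (A : 'M[R]_n) (x : 'cV[R]_m) :
  psdmx A -> F *m A *m F^T *m x = 0 -> A *m F^T *m x = 0.
Proof.
move=> Ap Fx; rewrite -mulmxA; apply: psdmx_form_eq0 => //.
rewrite trmx_mul trmxK -!mulmxA.
by move: Fx; rewrite -!mulmxA => ->; rewrite mulmx0 mxE.
Qed.

Lemma mpinv_sym n (A : 'M[R]_n) : A^T = A -> (mpinv A)^T = mpinv A.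
Proof.
move=> As; apply: (@penrose_uniq _ _ _ A); last exact: mpinvP.
have [A1 A2 A3 A4] := mpinvP A.
split.
- by have := congr1 trmx A1; rewrite !trmx_mul As mulmxA.
- by have := congr1 trmx A2; rewrite !trmx_mul As mulmxA.
- by rewrite trmx_mul trmxK As -A4 trmx_mul As.
- by rewrite trmx_mul trmxK As -A3 trmx_mul As.
Qed.

(** [1 - mpinv A *m A] projects onto the kernel of [A].  So inclusion of kernels
    is turned into inclusion of row spaces, in the form of an equation. *)
Lemma ker_sub_mulmx_mpinv m n (A : 'M[R]_n) (B : 'M[R]_(m, n)) :
  (forall x : 'cV_n, A *m x = 0 -> B *m x = 0) -> B *m mpinv A *m A = B.
Proof.
move=> AB; have [A1 _ _ _] := mpinvP A.
suff /eqP : B *m (1%:M - mpinv A *m A) = 0.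
  by rewrite mulmxBr mulmx1 mulmxA subr_eq0 => /eqP.
apply/matrixP => i j.
have entryE (M : 'M[R]_(m, n)) : M i j = (M *m (delta_mx j 0 : 'cV_n)) i 0.
  by rewrite -colE mxE.
rewrite !entryE mul0mx.
rewrite -mulmxA AB; first by [].
by rewrite mulmxA mulmxBr mulmx1 mulmxA A1 subrr mul0mx.
Qed.

(** The column-space version: the transpose of the equation that
    [ker_sub_mulmx_mpinv] provides, for a symmetric [A]. *)
Lemma mulmx_mpinv_range m n (A : 'M[R]_n) (B : 'M[R]_(m, n)) (w : 'cV[R]_m) :
  A^T = A -> B *m mpinv A *m A = B -> A *m (mpinv A *m (B^T *m w)) = B^T *m w.
Proof.
by move=> As BA; rewrite -{2}BA !trmx_mul mpinv_sym // As !mulmxA.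
Qed.

End QuadraticForms.

(** * The weighted least-squares minimizer *)

Lemma wnorm_mpinv (R : realType) m (W : 'M[R]_m) (x : 'cV[R]_m) : psdmx W ->
  wnorm (mpinv W) (W *m x) ^+ 2 = (x^T *m W *m x) 0 0.
Proof.
move=> [Ws Wp]; rewrite /wnorm.
have -> : (W *m x)^T *m mpinv W *m (W *m x) = x^T *m W *m x.
  rewrite trmx_mul Ws -!mulmxA; congr (_ *m _); rewrite !mulmxA.
  by have [->] := mpinvP W.
by rewrite sqr_sqrtr.
Qed.

Section ClosedForm.
Variables (R : realType) (n d : nat).
Variables (Phi : 'M[R]_(n, d)) (C : 'M[R]_d) (V : 'M[R]_n).
Hypotheses (Cpsd : psdmx C) (Vpsd : psdmx V).
Let S := Phi *m C *m Phi^T + V.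

(** Writing the residual as [V *m a] and [theta] as [C *m w] removes the
    pseudoinverses from the objective, and completing the square in [(a, w)]
    leaves the gap [b^T V b + u^T C u].  If it is 0 then [C *m u = 0]: the
    minimizer is unique even when [a] and [w] are not. *)
Lemma minimizers_set1 (x : 'cV[R]_n) :
  minimizers Phi C V (S *m x) = [set C *m Phi^T *m x].
Proof.
have [[Cs Cp] [Vs Vp]] := (Cpsd, Vpsd).
set y := S *m x; set th := C *m Phi^T *m x.
have res_th : y - Phi *m th = V *m x.
  by rewrite /y /S /th mulmxDl !mulmxA addrC addKr.
have th_range : th = C *m (Phi^T *m x) by rewrite mulmxA.
have feas_th : feasible Phi C V y th.
  by split; [exists x | exists (Phi^T *m x)].
have obj_th : objective Phi C V y th =
    (x^T *m V *m x) 0 0 + ((Phi^T *m x)^T *m C *m (Phi^T *m x)) 0 0.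
  by rewrite /objective res_th wnorm_mpinv // th_range wnorm_mpinv.
have gap th' : feasible Phi C V y th' -> exists (b : 'cV[R]_n) (u : 'cV[R]_d),
    th' - th = C *m u /\ objective Phi C V y th' =
      objective Phi C V y th + ((b^T *m V *m b) 0 0 + (u^T *m C *m u) 0 0).
  case=> -[a _ Va] [w _ Cw]; exists (a - x), (w - Phi^T *m x).
  split; first by rewrite mulmxBr Cw th_range.
  have Vb : V *m (a - x) = - (Phi *m C *m (w - Phi^T *m x)).
    rewrite mulmxBr Va -res_th -mulmxA mulmxBr Cw -th_range mulmxBr !opprB.
    by rewrite addrC addrA subrK.
  rewrite obj_th {1}/objective -Va -Cw !wnorm_mpinv //.
  rewrite -[a in LHS](subrKC x) -[w in LHS](subrKC (Phi^T *m x)).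
  rewrite !sym_formD //.
  have -> : (x^T *m V *m (a - x)) 0 0 =
      - ((Phi^T *m x)^T *m C *m (w - Phi^T *m x)) 0 0.
    by rewrite -mulmxA Vb mulmxN trmx_mul trmxK !mulmxA mxE.
  ring.
apply/seteqP; split=> [th' [feas_th' min_th']|_ ->]; last first.
  split=> // th' /gap [b [u [_ ->]]].
  by rewrite lerDl addr_ge0.
have [b [u [dth obj_th']]] := gap _ feas_th'.
have := min_th' _ feas_th; rewrite obj_th' gerDl => gap_le0.
have : (u^T *m C *m u) 0 0 = 0.
  have := Vp b; have := Cp u; lra.
by move/(psdmx_form_eq0 Cpsd) => Cu0; apply/eqP; rewrite -subr_eq0 dth Cu0.
Qed.

(** The normal equations of the gain [C *m Phi^T *m mpinv S].  They hold for a
    singular [S] because its kernel is contained in that of [C *m Phi^T]. *)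
Lemma gain_mulmx : C *m Phi^T *m mpinv S *m S = C *m Phi^T.
Proof.
apply: ker_sub_mulmx_mpinv => x Sx.
apply: psdmx_ker_congr => //.
exact: psdmx_ker_add (psdmx_congr _ Cpsd) Vpsd Sx.
Qed.

(** As [S] is symmetric, its kernel lying in those of [C *m Phi^T] and [V] means
    that its range contains those of [Phi *m C] and [V], on which
    [S *m mpinv S] is the identity. *)
Lemma mulmx_mpinv_sum (w : 'cV[R]_d) (a : 'cV[R]_n) :
  S *m (mpinv S *m (Phi *m (C *m w) + V *m a)) = Phi *m (C *m w) + V *m a.
Proof.
have [[Cs _] [Vs _]] := (Cpsd, Vpsd).
have [Ss _] : psdmx S by exact: psdmxD (psdmx_congr _ Cpsd) Vpsd.
have -> : Phi *m (C *m w) = (C *m Phi^T)^T *m w.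
  by rewrite trmx_mul trmxK Cs mulmxA.
have -> : V *m a = V^T *m a by rewrite Vs.
rewrite !mulmxDr (mulmx_mpinv_range w Ss gain_mulmx); congr (_ + _).
apply: mulmx_mpinv_range => //; apply: ker_sub_mulmx_mpinv => x.
rewrite /S addrC; exact: psdmx_ker_add Vpsd (psdmx_congr _ Cpsd).
Qed.

End ClosedForm.

(** * Minimizing bias plus variance *)

(** A stationary point of a convex quadratic function is a minimum: with
    [D = k - k0], the increment of the risk is [(D z)^2 + D V D^T] plus a linear
    term, and the equation on [k0] says that the linear term vanishes. *)
Lemma risk_minimal (R : realType) n (V : 'M[R]_n) (z : 'cV[R]_n) (t : R)
    (k0 k : 'rV[R]_n) :
  psdmx V -> k0 *m (z *m z^T + V) = t *: z^T ->
  (t - (k0 *m z) 0 0) ^+ 2 + (k0 *m V *m k0^T) 0 0 <=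
  (t - (k *m z) 0 0) ^+ 2 + (k *m V *m k^T) 0 0.
Proof.
move=> [Vs Vp] k0E; rewrite -(subrKC k0 k); set D := k - k0.
have cross : (k0 *m V *m D^T) 0 0 = (t - (k0 *m z) 0 0) * (D *m z) 0 0.
  have -> : k0 *m V = (t - (k0 *m z) 0 0) *: z^T.
    rewrite scalerBl.
    have <- : k0 *m z *m z^T = (k0 *m z) 0 0 *: z^T.
      by rewrite {1}[k0 *m z]mx11_scalar mul_scalar_mx.
    by rewrite -k0E mulmxDr mulmxA addrAC subrr add0r.
  by rewrite -scalemxAl mxE -[in RHS](trmx11 (D *m z)) trmx_mul.
have := sym_formD k0^T D^T Vs; rewrite -linearD /= !trmxK => ->.
have -> : ((k0 + D) *m z) 0 0 = (k0 *m z) 0 0 + (D *m z) 0 0.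
  by rewrite mulmxDl mxE.
rewrite cross; have := Vp D^T; rewrite trmxK.
have := sqr_ge0 ((D *m z) 0 0); rewrite -subr_ge0; nra.
Qed.

(** * Second moments of the noise *)

Import HBNNSimple.

(** Monotonicity almost everywhere asks for measurability only of the larger
    function: the integral of [f] is by definition a supremum over the simple
    functions below [f], and these are measurable and below [g] almost
    everywhere. *)
Lemma ae_ge0_le_integral_nonmeas disp (T : measurableType disp) (R : realType)
    (mu : {measure set T -> \bar R}) (f g : T -> \bar R) :
  (forall x, 0 <= f x)%E -> (forall x, 0 <= g x)%E -> measurable_fun setT g ->
  {ae mu, forall x, (f x <= g x)%E} ->
  (\int[mu]_x f x <= \int[mu]_x g x)%E.
Proof.
move=> f0 g0 mg fg; rewrite ge0_integralTE //.
apply: ge_ereal_sup => _ [h /= hf <-].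
rewrite -integralT_nnsfun; apply: ae_ge0_le_integral => //.
- by move=> x _; rewrite lee_fin.
- exact/measurable_EFinP.
- by apply: filterS fg => x fg _; rewrite (le_trans (hf x)).
Qed.

Section SecondMoments.
Variables (R : realType) (disp : measure_display) (T : measurableType disp).
Variables (P : probability T R) (n : nat) (eps : 'I_n -> {RV P >-> R}).
Variable V0 : 'M[R]_n.
Hypothesis eps_mean : forall i, 'E_P[eps i]%E = 0%E.
Hypothesis eps_cov :
  forall i j, covariance P (eps i) (eps j) = (V0 i j)%:E.

Let noise w : 'cV[R]_n := \col_i eps i w.

Lemma integral_noiseM i j : (\int[P]_w (eps i w * eps j w)%:E)%E = (V0 i j)%:E.
Proof.
rewrite -eps_cov covariance.unlock !eps_mean /= expectation.unlock.
by apply: eq_integral => w _; rewrite !fctE /= !subr0.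
Qed.

Lemma integrable_noise_sqr i :
  P.-integrable setT (fun w => (eps i w ^+ 2)%:E).
Proof.
apply/integrableP; split.
  by apply/measurable_EFinP; exact: measurable_funX.
under eq_integral => w _ do rewrite gee0_abs ?lee_fin ?sqr_ge0 // expr2.
by rewrite integral_noiseM ltry.
Qed.

(** From [eps i ^+ 2] by [`|x| <= 1 + x ^+ 2]. *)
Lemma integrable_noise i : P.-integrable setT (fun w => (eps i w)%:E).
Proof.
apply: (@le_integrable _ _ _ P setT measurableT _
    (fun w => 1%:E + (eps i w ^+ 2)%:E)%E).
- exact/measurable_EFinP.
- move=> w _; rewrite -EFinD !abse_EFin lee_fin.
  rewrite (ger0_norm (addr_ge0 ler01 _)) ?sqr_ge0 //.
  rewrite ler_norml.
  by have := sqr_ge0 (eps i w - 1); have := sqr_ge0 (eps i w + 1); nra.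
- apply: integrableD (integrable_noise_sqr i) => //.
  exact: finite_measure_integrable_cst.
Qed.

Lemma integrable_noiseM i j :
  P.-integrable setT (fun w => (eps i w * eps j w)%:E).
Proof.
apply: (@le_integrable _ _ _ P setT measurableT _
    (fun w => (eps i w ^+ 2)%:E + (eps j w ^+ 2)%:E)%E).
- by apply/measurable_EFinP; exact: measurable_funM.
- move=> w _; rewrite -EFinD !abse_EFin lee_fin.
  rewrite (ger0_norm (addr_ge0 _ _)) ?sqr_ge0 //.
  by rewrite ler_norml; nra.
- exact: integrableD (integrable_noise_sqr i) (integrable_noise_sqr j).
Qed.

(** Expansion of the square: the linear term vanishes because the noise is
    centered, and the quadratic term brings in the covariances. *)
Lemma second_moment_affine (a : R) (c : 'rV[R]_n) :
  (\int[P]_w ((a + (c *m noise w) 0 0) ^+ 2)%:E)%E =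
  (a ^+ 2 + (c *m V0 *m c^T) 0 0)%:E.
Proof.
pose lin i w : \bar R := ((a *+ 2 * c 0 i)%:E * (eps i w)%:E)%E.
pose quad (p : 'I_n * 'I_n) w : \bar R :=
  ((c 0 p.1 * c 0 p.2)%:E * (eps p.1 w * eps p.2 w)%:E)%E.
have ilin i : P.-integrable setT (lin i).
  exact: integrableZl (integrable_noise i).
have iquad p : P.-integrable setT (quad p).
  exact: integrableZl (integrable_noiseM p.1 p.2).
have expand w : ((a + (c *m noise w) 0 0) ^+ 2)%:E =
    ((a ^+ 2)%:E + (\sum_i lin i w + \sum_p quad p w))%E.
  rewrite !sumEFin -!EFinD; congr EFin.
  rewrite sqrrD -addrA; congr (_ + (_ + _)).
    rewrite -mulrnAl mxE mulr_sumr; apply: eq_bigr => i _.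
    by rewrite mxE mulrA.
  rewrite -(pair_bigA _ (fun i j => c 0 i * c 0 j * (eps i w * eps j w))) /=.
  rewrite expr2 mxE mulr_suml; apply: eq_bigr => i _.
  rewrite mulr_sumr; apply: eq_bigr => j _.
  by rewrite !mxE mulrACA.
under eq_integral => w _ do rewrite expand.
rewrite integralD //; last 2 first.
- exact: finite_measure_integrable_cst.
- by apply: integrableD => //; exact: integrable_sum.
rewrite integralD //; [|exact: integrable_sum..].
rewrite !integral_sum //.
have -> : (\int[P]_w (a ^+ 2)%:E = (a ^+ 2)%:E)%E.
  by have := expectation_cst P (a ^+ 2); rewrite expectation.unlock.
have -> : (\sum_i \int[P]_w lin i w = 0)%E.
  rewrite big1 // => i _; rewrite integralZl //; last exact: integrable_noise.
  by have := eps_mean i; rewrite expectation.unlock => ->; rewrite mule0.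
rewrite add0e.
under eq_bigr => p _.
  rewrite integralZl //; last exact: integrable_noiseM.
  rewrite integral_noiseM; over.
rewrite sumEFin -EFinD; congr (_ + _)%:E.
rewrite -(pair_bigA _ (fun i j => c 0 i * c 0 j * V0 i j)) /=.
rewrite exchange_big mxE; apply: eq_bigr => j _.
rewrite !mxE mulr_suml; apply: eq_bigr => i _.
by rewrite mulrAC.
Qed.

Lemma measurable_affine_noise (a : R) (c : 'rV[R]_n) :
  measurable_fun setT (fun w => a + (c *m noise w) 0 0).
Proof.
apply: measurable_funD => //.
have -> : (fun w => (c *m noise w) 0 0) = (fun w => \sum_i c 0 i * eps i w).
  by apply/funext => w; rewrite mxE; apply: eq_bigr => i _; rewrite mxE.
by apply: measurable_sum => i; exact: measurable_funM.
Qed.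

(** Let [X = 1 - V0 *m mpinv V0]; then [X *m V0 = 0], so each entry of
    [X *m noise] has second moment 0 and vanishes almost surely.  Where all of
    them vanish, [noise = V0 *m (mpinv V0 *m noise)]. *)
Lemma noise_range : psdmx V0 -> {ae P, forall w, exists a, noise w = V0 *m a}.
Proof.
move=> [Vs _]; have [V1 _ _ _] := mpinvP V0.
pose X : 'M[R]_n := 1%:M - V0 *m mpinv V0.
have ae0 i : {ae P, forall w, (row i X *m noise w) 0 0 = 0}.
  pose f w := (row i X *m noise w) 0 0.
  have mf : measurable_fun setT f.
    have := measurable_affine_noise 0 (row i X).
    by under eq_fun do rewrite add0r.
  have : (\int[P]_w `|(f w ^+ 2)%:E| = 0)%E.
    under eq_integral => w _ do
      rewrite gee0_abs ?lee_fin ?sqr_ge0 // -[f w]add0r.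
    rewrite second_moment_affine expr0n add0r.
    by rewrite -row_mul mulmxBl mul1mx V1 subrr row0 mul0mx mxE.
  move/ae_eq_integral_abs => /(_ measurableT) sq0; apply: filterS (sq0 _).
    by move=> w /(_ I) /= [] /eqP; rewrite sqrf_eq0 => /eqP.
  by apply/measurable_EFinP; exact: measurable_funX.
have : {ae P, forall w, forall i, (row i X *m noise w) 0 0 = 0}.
  exact: filter_forall.
apply: filterS => w Xw; exists (mpinv V0 *m noise w).
apply/eqP; rewrite -subr_eq0; apply/eqP/matrixP => i j; rewrite ord1 [RHS]mxE.
have := Xw i; rewrite -row_mul mxE => <-.
by rewrite mulmxBl mul1mx mulmxA.
Qed.

End SecondMoments.

(** * Mean squared error of a linear estimator *)

Section LinearRisk.
Variables (R : realType) (disp : measure_display) (T : measurableType disp).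
Variables (P : probability T R) (n d : nat) (eps : 'I_n -> {RV P >-> R}).
Variables (Phi : 'M[R]_(n, d)) (theta0 : 'cV[R]_d) (V0 : 'M[R]_n).
Hypothesis eps_mean : forall i, 'E_P[eps i]%E = 0%E.
Hypothesis eps_cov :
  forall i j, covariance P (eps i) (eps j) = (V0 i j)%:E.
Let y := observation Phi theta0 eps.

Lemma norm2_sqr m (x : 'cV[R]_m) : norm2 x ^+ 2 = \sum_i x i 0 ^+ 2.
Proof. by rewrite sqr_sqrtr // sumr_ge0 // => i _; exact: sqr_ge0. Qed.

Lemma error_coord (K : 'M[R]_(d, n)) w i :
  (theta0 - K *m y w) i 0 =
  theta0 i 0 - (row i K *m (Phi *m theta0)) 0 0 +
    (- row i K *m \col_j eps j w) 0 0.
Proof.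
have addE m (A B : 'cV[R]_m) k : (A + B) k 0 = A k 0 + B k 0 by rewrite mxE.
have oppE m (A : 'cV[R]_m) k : (- A) k 0 = - A k 0 by rewrite mxE.
have rowE (A : 'cV[R]_d) : (row i A) 0 0 = A i 0 by rewrite mxE.
rewrite /y /observation mulmxDr opprD addrA mulNmx -!row_mul.
by rewrite !addE !oppE !rowE.
Qed.

Lemma measurable_error (K : 'M[R]_(d, n)) i :
  measurable_fun setT (fun w => (theta0 - K *m y w) i 0).
Proof.
under eq_fun do rewrite error_coord.
exact: measurable_affine_noise.
Qed.

Lemma MSE_linear (K : 'M[R]_(d, n)) :
  MSE P theta0 (fun w => K *m y w) =
  (\sum_i ((theta0 i 0 - (row i K *m (Phi *m theta0)) 0 0) ^+ 2 +
           (row i K *m V0 *m (row i K)^T) 0 0))%:E.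
Proof.
rewrite /MSE expectation.unlock.
under eq_integral => w _ do rewrite norm2_sqr -sumEFin.
rewrite ge0_integral_sum //; last 2 first.
- move=> i; apply/measurable_EFinP.
  by apply: measurable_funX; exact: measurable_error.
- by move=> i w _; rewrite lee_fin sqr_ge0.
rewrite -sumEFin; apply: eq_bigr => i _.
under eq_integral => w _ do rewrite error_coord.
rewrite (second_moment_affine eps_mean eps_cov).
by rewrite linearN /= mulNmx mulmxN mulNmx opprK.
Qed.

Lemma MSE_le_linear (K : 'M[R]_(d, n)) (theta_hat : T -> 'cV[R]_d) :
  {ae P, forall w, theta_hat w = K *m y w} ->
  (MSE P theta0 theta_hat <= MSE P theta0 (fun w => K *m y w))%E.
Proof.
move=> eqK; rewrite /MSE expectation.unlock.
apply: ae_ge0_le_integral_nonmeas => [w|w||].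
- by rewrite lee_fin sqr_ge0.
- by rewrite lee_fin sqr_ge0.
- apply/measurable_EFinP; under eq_fun do rewrite norm2_sqr.
  apply: measurable_sum => i.
  by apply: measurable_funX; exact: measurable_error.
- by apply: filterS eqK => w ->.
Qed.

End LinearRisk.

(** Makes [theta0] a feasible point of the weighted problem, also when it is 0
    and the weight [C] vanishes. *)
Lemma outer_range (R : realType) d (t : 'cV[R]_d) (a : R) : a != 0 ->
  exists u : 'cV[R]_d, (a *: (t *m t^T)) *m u = t.
Proof.
move=> a0; have [->|t0] := eqVneq t 0.
  by exists 0; rewrite mulmx0.
have q0 : (t^T *m t) 0 0 != 0.
  by apply: contra_neq t0 => /sqnorm_eq0.
move: q0 (mx11_scalar (t^T *m t)); move: ((t^T *m t) 0 0) => q q0 ttE.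
exists ((a * q)^-1 *: t).
rewrite -scalemxAl -scalemxAr -mulmxA ttE mul_mx_scalar.
rewrite !scalerA [X in X *: t](_ : _ = 1) ?scale1r //.
by field; rewrite ?a0 ?q0.
Qed.

Theorem theorem3 (R : realType) (disp : measure_display)
    (T : measurableType disp) (P : probability T R) (n d : nat)
    (Phi : 'M[R]_(n, d)) (theta0 : 'cV[R]_d) (V0 : 'M[R]_n)
    (eps : 'I_n -> {RV P >-> R})
    (V0_psd : psdmx V0)
    (eps_mean : forall i : 'I_n, 'E_P[eps i]%E = 0%E)
    (eps_cov : forall i j : 'I_n, covariance P (eps i) (eps j) = (V0 i j)%:E)
    (alpha : R) (alpha_gt0 : 0 < alpha) :
  let y := observation Phi theta0 eps in
  let C := alpha *: (theta0 *m theta0^T) in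
  let V := alpha *: V0 in
  let theta_hat := estimator Phi C V in
  exists K0 : 'M[R]_(d, n),
    [/\ {ae P, forall w, minimizers Phi C V (y w) = [set theta_hat (y w)]},
        {ae P, forall w, theta_hat (y w) = K0 *m y w}
      & forall K : 'M[R]_(d, n),
          (MSE P theta0 (fun w => theta_hat (y w))
           <= MSE P theta0 (fun w => K *m y w))%E].
Proof.
move=> y C V theta_hat.
have Cpsd : psdmx C by apply: psdmxZ (psdmx_outer _); exact: ltW.
have Vpsd : psdmx V by apply: psdmxZ V0_psd; exact: ltW.
pose S := Phi *m C *m Phi^T + V.
pose K0 := C *m Phi^T *m mpinv S.
have minK0 : {ae P, forall w, minimizers Phi C V (y w) = [set K0 *m y w]}.
  apply: filterS (noise_range eps_mean eps_cov V0_psd) => w [a noise_a].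
  have [u Cu] := outer_range theta0 (lt0r_neq0 alpha_gt0).
  have yw : y w = S *m (mpinv S *m y w).
    have -> : y w = Phi *m (C *m u) + V *m (alpha^-1 *: a).
      rewrite /y /observation noise_a Cu -scalemxAl -scalemxAr scalerA.
      by rewrite mulfV ?scale1r ?gt_eqF.
    by rewrite mulmx_mpinv_sum.
  by rewrite {1}yw minimizers_set1 // !mulmxA.
have hatK0 : {ae P, forall w, theta_hat (y w) = K0 *m y w}.
  apply: filterS minK0 => w minE.
  rewrite /theta_hat /estimator minE; exact: xget_unique.
exists K0; split=> //.
  by apply: filterS2 minK0 hatK0 => w -> ->.
move=> K.
have leK0 := MSE_le_linear (theta_hat := fun w => theta_hat (y w)) hatK0.
apply: le_trans leK0 _.
rewrite !(MSE_linear _ _ eps_mean eps_cov) lee_fin; apply: ler_sum => i _.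
apply: risk_minimal => //; rewrite -row_mul.
set z := Phi *m theta0.
have -> : K0 *m (z *m z^T + V0) = theta0 *m z^T.
  apply: (scalerI (lt0r_neq0 alpha_gt0)).
  have CPhi : C *m Phi^T = alpha *: (theta0 *m z^T).
    by rewrite /C /z trmx_mul -scalemxAl mulmxA.
  rewrite -CPhi -(gain_mulmx Phi Cpsd Vpsd) -/S -/K0 scalemxAr; congr (_ *m _).
  by rewrite scalerDr /S -mulmxA CPhi -scalemxAr mulmxA.
by rewrite row_mul [row i theta0]mx11_scalar mul_scalar_mx mxE.
Qed.
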